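(* Let $D_2^\epsilon$ be the discretisation of the second derivative operator $\partial_x(\epsilon\,\partial_x\,\cdot\,)$ given in the context, with possibly varying coefficients $\epsilon_i\ge0$, either in a periodic domain or on a bounded domain with nodes $x_0,\dots,x_N$ and $\epsilon_0=0=\epsilon_N$. Then $D_2^\epsilon$ is entropy dissipative for every convex entropy $U$; that is, for every $m\ge1$, every convex differentiable function $U\colon\mathbb{R}^m\to\mathbb{R}$ and every grid function $\mathbf{u}$ with values in $\mathbb{R}^m$, $$\sum_i U'(\mathbf{u}_i)\cdot(D_2^\epsilon\mathbf{u})_i\le0\quad\text{(periodic case)},\qquad \sum_{i=0}^N H_{ii}\,U'(\mathbf{u}_i)\cdot(D_2^\epsilon\mathbf{u})_i\le0\quad\text{(bounded case)}.$$
   Context: The grid is uniform with spacing $h>0$. A grid function is a family $\mathbf{u}=(\mathbf{u}_i)_i$ of values at the nodes, possibly vector-valued in $\mathbb{R}^m$; $D_2^\epsilon$ acts componentwise. $U'$ denotes the gradient of $U$ and $\cdot$ the Euclidean inner product. The coefficients are nodal values $\epsilon_i\ge0$. Periodic case: indices are taken modulo the number of nodes, and for every $i$ $$(D_2^\epsilon\mathbf{u})_i=\frac{\epsilon_i+\epsilon_{i+1}}{2h^2}\mathbf{u}_{i+1}-\frac{\epsilon_{i-1}+2\epsilon_i+\epsilon_{i+1}}{2h^2}\mathbf{u}_i+\frac{\epsilon_{i-1}+\epsilon_i}{2h^2}\mathbf{u}_{i-1}.$$ (For constant $\epsilon\equiv1$ this is the classical operator $(\mathbf{u}_{i+1}-2\mathbf{u}_i+\mathbf{u}_{i-1})/h^2$.)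 Bounded case with nodes $x_0,\dots,x_N$, $N\ge2$: the same formula is used for $1\le i\le N-1$, with the boundary closures $$(D_2^\epsilon\mathbf{u})_0=\tfrac{1}{h^2}\bigl[(2\epsilon_0-\epsilon_1)\mathbf{u}_0+(-3\epsilon_0+\epsilon_1)\mathbf{u}_1+\epsilon_0\mathbf{u}_2\bigr],$$ $$(D_2^\epsilon\mathbf{u})_N=\tfrac{1}{h^2}\bigl[(2\epsilon_N-\epsilon_{N-1})\mathbf{u}_N+(-3\epsilon_N+\epsilon_{N-1})\mathbf{u}_{N-1}+\epsilon_N\mathbf{u}_{N-2}\bigr],$$ which for $\epsilon_0=0=\epsilon_N$ become $(D_2^\epsilon\mathbf{u})_0=\epsilon_1(\mathbf{u}_1-\mathbf{u}_0)/h^2$ and $(D_2^\epsilon\mathbf{u})_N=-\epsilon_{N-1}(\mathbf{u}_N-\mathbf{u}_{N-1})/h^2$. The discrete integral uses the diagonal quadrature weights $H=\operatorname{diag}(1/2,1,\dots,1,1/2)$ (up to the positive factor $h$), i.e. $H_{00}=H_{NN}=1/2$ and $H_{ii}=1$ for $1\le i\le N-1$. *)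

(* Defs.v *)
From HB Require Import structures.
From mathcomp Require Import all_boot all_order all_algebra.
From mathcomp Require Import all_classical all_reals all_analysis.

Set Implicit Arguments.
Unset Strict Implicit.
Unset Printing Implicit Defensive.

Import Order.TTheory GRing.Theory Num.Theory.
Import numFieldNormedType.Exports.

Local Open Scope ring_scope.

Section Gradient.
Variables (R : realType) (m : nat).

Definition dotrv (v w : 'rV[R]_m) : R := \sum_(j < m) v 0 j * w 0 j.

Definition gradient (U : 'rV[R]_m -> R) (x : 'rV[R]_m) : 'rV[R]_m :=
  \row_(j < m) 'D_(delta_mx 0 j) U x.

End Gradient.

Section SecondDerivative.
Variables (R : realType) (m : nat).
Implicit Types h : R.

(* The suffixes m, c, p refer to the nodes i - 1, i, i + 1. *)
Definition D2_stencil h (em ec ep : R) (um uc up : 'rV[R]_m) : 'rV[R]_m :=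
  ((ec + ep) / (2 * h ^+ 2)) *: up
  - ((em + 2 * ec + ep) / (2 * h ^+ 2)) *: uc
  + ((em + ec) / (2 * h ^+ 2)) *: um.

(* The suffixes 0, 1, 2 give the distance from the boundary node. *)
Definition D2_closure h (e0 e1 : R) (u0 u1 u2 : 'rV[R]_m) : 'rV[R]_m :=
  (h ^+ 2)^-1 *:
    ((2 * e0 - e1) *: u0 + (- (3 * e0) + e1) *: u1 + e0 *: u2).

(* ordS and ord_pred are the cyclic successor and predecessor on 'I_n. *)
Definition D2_periodic n h (eps : 'I_n -> R) (u : 'I_n -> 'rV[R]_m)
    (i : 'I_n) : 'rV[R]_m :=
  D2_stencil h (eps (ord_pred i)) (eps i) (eps (ordS i))
    (u (ord_pred i)) (u i) (u (ordS i)).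

(* The nodes x_0, ..., x_N are indexed by 'I_N.+1. For 2 <= N every argument
   of inord below is at most N, so that inord k is the node of index k. *)
Definition D2_bounded N h (eps : 'I_N.+1 -> R) (u : 'I_N.+1 -> 'rV[R]_m)
    (i : 'I_N.+1) : 'rV[R]_m :=
  if i == ord0 then
    D2_closure h (eps ord0) (eps (inord 1))
      (u ord0) (u (inord 1)) (u (inord 2))
  else if i == ord_max then
    D2_closure h (eps ord_max) (eps (inord (N - 1)%N))
      (u ord_max) (u (inord (N - 1)%N)) (u (inord (N - 2)%N))
  else
    D2_stencil h (eps (inord (i - 1)%N)) (eps i) (eps (inord (i + 1)%N))
      (u (inord (i - 1)%N)) (u i) (u (inord (i + 1)%N)).

End SecondDerivative.

Definition quadrature_weight (R : realType) N (i : 'I_N.+1) : R :=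
  if (i == ord0) || (i == ord_max) then 2^-1 else 1.

(* Main.v *)
Require Import Defs.
From mathcomp Require Import all_boot all_order all_algebra.
From mathcomp Require Import all_classical all_reals all_analysis.
From mathcomp Require Import ring lra.
Import Order.TTheory GRing.Theory Num.Theory.
Import numFieldNormedType.Exports.
Local Open Scope ring_scope.

(** The coefficients of [D2_stencil] sum to zero, so its value at a node is
    [a (up - uc) + b (um - uc)] with [a] and [b] nonnegative; where [eps]
    vanishes at the end of a bounded grid, [D2_closure] is likewise a
    nonnegative multiple of the difference to the only neighbour. The tangent
    inequality [U'(x) . (y - x) <= U y - U x] of a convex differentiable [U]
    ([convex_gradient_le]) therefore gives, node by node,
    [U'(u_i) . (D2 u)_i <= (D2 (U o u))_i]. Away from the ends of a bounded
    grid, the right-hand side is the difference of the fluxes of the scalar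
    grid function [U o u] through the two sides of the node
    ([dotrv_D2_stencil_le]); at an end, the quadrature weight 1/2 turns it
    into the single flux towards the neighbour ([dotrv_D2_closure_le]). Hence
    its (weighted) sum over the grid telescopes to zero. *)

(** * The tangent inequality for convex functions *)

(** For [t] in (0, 1], convexity on the segment from [x] to [y] bounds the
    difference quotient of [U] at [x] in the direction [y - x] by
    [U y - U x]; the directional derivative is its limit as [t] tends to 0
    from the right. *)
Lemma convex_derive_le (R : realType) (E : normedModType R) (U : E -> R)
    (x y : E) :
  @convex_function R E [set: E]%classic U -> derivable U x (y - x) ->
  'D_(y - x) U x <= U y - U x.
Proof.
move=> cU dU; rewrite /derive cvg_at_rightE //.
apply: limr_le.
  by apply/cvg_ex; exists ('D_(y - x) U x); exact: cvg_dnbhs_at_right.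
near=> t.
have t0 : 0 < t by near: t; exact: nbhs_right_gt.
have t1 : t <= 1 by near: t; apply: nbhs_right_le; exact: ltr01.
have := cU (Itv01 (ltW t0) t1) y x.
rewrite !inE => /(_ I I); rewrite convRE /= /conv /= /unstable.onem => cUt.
have -> : t *: (y - x) + x = t *: y + (1 - t) *: x.
  by rewrite scalerBr scalerBl scale1r -addrA [- _ + x]addrC.
have -> : t^-1 *: (U (t *: y + (1 - t) *: x) - U x)
        = (U (t *: y + (1 - t) *: x) - U x) / t by rewrite mulrC.
by rewrite ler_pdivrMr //; lra.
Unshelve. all: by end_near. Qed.

Lemma dotrv_gradient (R : realType) (m : nat) (U : 'rV[R]_m -> R)
    (x v : 'rV[R]_m) :
  differentiable U x -> dotrv (gradient U x) v = 'D_v U x.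
Proof.
move=> dU; rewrite deriveE // [v in RHS]row_sum_delta linear_sum /=.
apply: eq_bigr => j _; rewrite mxE deriveE // linearZ /=.
by rewrite mulrC.
Qed.

Lemma convex_gradient_le (R : realType) (m : nat) (U : 'rV[R]_m -> R)
    (x y : 'rV[R]_m) :
  @convex_function R 'rV[R]_m [set: 'rV[R]_m]%classic U ->
  differentiable U x -> dotrv (gradient U x) (y - x) <= U y - U x.
Proof.
move=> cU dU; rewrite dotrv_gradient //.
by apply: convex_derive_le => //; exact: diff_derivable.
Qed.

Lemma dotrvDr (R : realType) (m : nat) (g v w : 'rV[R]_m) :
  dotrv g (v + w) = dotrv g v + dotrv g w.
Proof.
by rewrite /dotrv -big_split; apply: eq_bigr => j _; rewrite mxE mulrDr.
Qed.

Lemma dotrvZr (R : realType) (m : nat) (a : R) (g v : 'rV[R]_m) :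
  dotrv g (a *: v) = a * dotrv g v.
Proof.
by rewrite /dotrv big_distrr; apply: eq_bigr => j _; rewrite mxE mulrCA.
Qed.

(** * The discrete operator and numerical fluxes *)

(** The numerical flux of a scalar grid function between two adjacent nodes
    with coefficients [e0], [e1] and values [v0], [v1]; it is divided by an
    extra [h], so that the operator is a plain difference of fluxes. *)
Definition flux {R : realType} (h e0 e1 v0 v1 : R) : R :=
  (e0 + e1) / (2 * h ^+ 2) * (v1 - v0).

Lemma dotrv_D2_stencil_le (R : realType) (h : R) (m : nat) (U : 'rV[R]_m -> R)
    (em ec ep : R) (um uc up : 'rV[R]_m) :
  0 <= em -> 0 <= ec -> 0 <= ep ->
  @convex_function R 'rV[R]_m [set: 'rV[R]_m]%classic U ->
  differentiable U uc ->
  dotrv (gradient U uc) (D2_stencil h em ec ep um uc up) <=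
    flux h ec ep (U uc) (U up) - flux h em ec (U um) (U uc).
Proof.
move=> em0 ec0 ep0 cU dU.
have -> : D2_stencil h em ec ep um uc up =
    ((ec + ep) / (2 * h ^+ 2)) *: (up - uc) +
    ((em + ec) / (2 * h ^+ 2)) *: (um - uc).
  by apply/rowP => j; rewrite !mxE; ring.
rewrite dotrvDr !dotrvZr /flux -mulrN opprB.
by apply: lerD; apply: ler_wpM2l; rewrite ?convex_gradient_le //;
  apply: divr_ge0; rewrite ?addr_ge0 // mulr_ge0 // sqr_ge0.
Qed.

(** At the right end [u1] is the left neighbour of [u0], so that the bound is
    the opposite of the flux oriented from left to right. *)
Lemma dotrv_D2_closure_le (R : realType) (h : R) (m : nat) (U : 'rV[R]_m -> R)
    (e1 : R) (u0 u1 u2 : 'rV[R]_m) :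
  0 <= e1 ->
  @convex_function R 'rV[R]_m [set: 'rV[R]_m]%classic U ->
  differentiable U u0 ->
  2^-1 * dotrv (gradient U u0) (D2_closure h 0 e1 u0 u1 u2) <=
    flux h 0 e1 (U u0) (U u1).
Proof.
move=> e10 cU dU.
have -> : D2_closure h 0 e1 u0 u1 u2 = (e1 / h ^+ 2) *: (u1 - u0).
  by apply/rowP => j; rewrite !mxE; ring.
have half : e1 / (2 * h ^+ 2) = 2^-1 * (e1 / h ^+ 2) by rewrite invfM mulrCA.
rewrite dotrvZr /flux add0r half mulrA.
by apply: ler_wpM2l; rewrite ?convex_gradient_le // !mulr_ge0 // invr_ge0
  ?sqr_ge0.
Qed.

Lemma fluxC (R : realType) (h e0 e1 v0 v1 : R) :
  flux h e1 e0 v1 v0 = - flux h e0 e1 v0 v1.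
Proof. by rewrite /flux -mulrN opprB [e1 + e0]addrC. Qed.

(** * Dissipation *)

Lemma D2_periodic_dissipative (R : realType) (h : R) (n : nat)
    (eps : 'I_n -> R) (m : nat) (U : 'rV[R]_m -> R) (u : 'I_n -> 'rV[R]_m) :
  (forall i, 0 <= eps i) ->
  @convex_function R 'rV[R]_m [set: 'rV[R]_m]%classic U ->
  (forall x, differentiable U x) ->
  \sum_(i < n) dotrv (gradient U (u i)) (D2_periodic h eps u i) <= 0.
Proof.
move=> eps0 cU dU.
pose F i := flux h (eps i) (eps (ordS i)) (U (u i)) (U (u (ordS i))).
have sumF : \sum_(i < n) (F i - F (ord_pred i)) = 0.
  by rewrite sumrB [X in X - _](reindex_inj (@ord_pred_inj n)) subrr.
rewrite -[leRHS]sumF; apply: ler_sum => i _; rewrite /F ord_predK.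
exact: dotrv_D2_stencil_le.
Qed.

Lemma D2_bounded_dissipative (R : realType) (h : R) (N : nat)
    (eps : 'I_N.+1 -> R) (m : nat) (U : 'rV[R]_m -> R)
    (u : 'I_N.+1 -> 'rV[R]_m) :
  (0 < N)%N -> (forall i, 0 <= eps i) -> eps ord0 = 0 -> eps ord_max = 0 ->
  @convex_function R 'rV[R]_m [set: 'rV[R]_m]%classic U ->
  (forall x, differentiable U x) ->
  \sum_(i < N.+1)
    quadrature_weight R i *
      dotrv (gradient U (u i)) (D2_bounded h eps u i) <= 0.
Proof.
move=> N0 eps0 e0 eN cU dU.
pose e k := eps (inord k); pose V k := U (u (inord k)).
(* G k is the flux between nodes k - 1 and k; none crosses the two ends. *)
pose G k := if (0 < k <= N)%N then flux h (e k.-1) (e k) (V k.-1) (V k) else 0.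
have sumG : \sum_(i < N.+1) (G i.+1 - G i) = 0.
  rewrite -(big_mkord xpredT (fun k => G k.+1 - G k)) telescope_sumr //.
  by rewrite /G /= ltnn subrr.
rewrite -[leRHS]sumG; apply: ler_sum => i _.
rewrite /quadrature_weight /D2_bounded.
have [->|i_neq0] := eqVneq i ord0.
  rewrite /= /G /= N0 subr0 /e /V e0.
  have -> : inord 0 = ord0 :> 'I_N.+1 by apply/val_inj; rewrite /= inordK.
  by rewrite e0; exact: dotrv_D2_closure_le.
have i_gt0 : (0 < i)%N by rewrite lt0n.
have [->|i_neqN] := eqVneq i ord_max.
  rewrite /= /G /= ltnn N0 leqnn /= sub0r -fluxC /e /V subn1.
  have -> : inord N = ord_max :> 'I_N.+1 by apply/val_inj; rewrite /= inordK.
  by rewrite eN; exact: dotrv_D2_closure_le.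
have i_ltN : (i < N)%N.
  by rewrite ltn_neqAle -ltnS ltn_ord andbT.
rewrite /= mul1r /G i_gt0 i_ltN (ltnW i_ltN) /= /e /V inord_val subn1 addn1.
exact: dotrv_D2_stencil_le.
Qed.

Theorem theorem4p1 (R : realType) (h : R) (h_gt0 : 0 < h) :
  (forall (n : nat) (eps : 'I_n -> R),
     (0 < n)%N -> (forall i, 0 <= eps i) ->
   forall (m : nat) (U : 'rV[R]_m -> R),
     (0 < m)%N ->
     @convex_function R 'rV[R]_m [set: 'rV[R]_m]%classic U ->
     (forall x, differentiable U x) ->
   forall u : 'I_n -> 'rV[R]_m,
     \sum_(i < n) dotrv (gradient U (u i)) (D2_periodic h eps u i) <= 0)
  /\
  (forall (N : nat) (eps : 'I_N.+1 -> R),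
     (2 <= N)%N -> (forall i, 0 <= eps i) ->
     eps ord0 = 0 -> eps ord_max = 0 ->
   forall (m : nat) (U : 'rV[R]_m -> R),
     (0 < m)%N ->
     @convex_function R 'rV[R]_m [set: 'rV[R]_m]%classic U ->
     (forall x, differentiable U x) ->
   forall u : 'I_N.+1 -> 'rV[R]_m,
     \sum_(i < N.+1)
       quadrature_weight R i *
         dotrv (gradient U (u i)) (D2_bounded h eps u i) <= 0).
Proof.
split=> [n eps _ eps0 m U _ cU dU u|N eps N2 eps0 e0 eN m U _ cU dU u].
  exact: D2_periodic_dissipative.
exact: D2_bounded_dissipative (ltnW N2) _ _ _ _ _.
Qed.
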